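(* Let $f:[\underline{x},\overline{x}]\to\mathbb{R}$ be concave and $N\ge 3$. A breakpoint set $(x_1,\dots,x_N)$ on $[\underline{x},\overline{x}]$ in which all the interval maximum absolute errors are equal, i.e. $E(x_1,x_2)=E(x_2,x_3)=\cdots=E(x_{N-1},x_N)$, is both unique (no other breakpoint set with $N$ breakpoints on $[\underline{x},\overline{x}]$ has all its interval maximum absolute errors equal) and optimal for minimizing the maximum absolute error.
   Context: For $u<v$ in $[\underline{x},\overline{x}]$, let $L_{u,v}(x)=f(u)+\frac{f(v)-f(u)}{v-u}(x-u)$ be the linear function through $(u,f(u))$ and $(v,f(v))$, and let $E(u,v)=\max_{x\in[u,v]}|f(x)-L_{u,v}(x)|$ be the maximum absolute error of the interval $[u,v]$. A breakpoint set with $N$ breakpoints on $[\underline{x},\overline{x}]$ is a tuple $(x_1,\dots,x_N)$ with $x_1=\underline{x}$, $x_N=\overline{x}$ (fixed endpoints) and $x_i<x_{i+1}$ for all $i$. Its maximum absolute error is $E_{\max}=\max_{1\le i\le N-1}E(x_i,x_{i+1})$. A breakpoint set is optimal for minimizing the maximum absolute error if its $E_{\max}$ is minimal among all breakpoint sets with $N$ breakpoints on $[\underline{x},\overline{x}]$.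
   Formalization: Uniqueness is false for e.g. affine f (all errors are 0), so it is proved only when no set of N−1 breakpoints has maximum absolute error 0, which is exactly when it can hold; the maxima defining E(u,v) are assumed to exist; optimality has no further restriction. *)

(* Defs.v *)
(* Everything below is stated in MathComp-Analysis. *)
From HB Require Import structures.
From mathcomp Require Import all_boot all_order all_algebra.
From mathcomp Require Import all_classical all_reals all_analysis.

Set Implicit Arguments.
Unset Strict Implicit.
Unset Printing Implicit Defensive.

Import Order.TTheory GRing.Theory Num.Theory.

Local Open Scope classical_set_scope.
Local Open Scope ring_scope.

(* A function on [a, b] is represented by a total f : R -> R; no definition
   below looks at the values of f outside [a, b] when applied to points of
   [a, b]. *)

Definition concave_on (R : realType) (a b : R) (f : R -> R) : Prop :=
  convex_function (`[a, b] : set R) (fun x : R => - f x).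

Definition chord (R : realType) (f : R -> R) (u v x : R) : R :=
  f u + (f v - f u) / (v - u) * (x - u).

Definition abs_error (R : realType) (f : R -> R) (u v x : R) : R :=
  `|f x - chord f u v x|.

Definition has_max_error (R : realType) (f : R -> R) (u v : R) : Prop :=
  exists2 x, x \in `[u, v] &
    forall y, y \in `[u, v] -> abs_error f u v y <= abs_error f u v x.

(* E(u, v); the supremum is a maximum exactly when has_max_error f u v. *)
Definition max_error (R : realType) (f : R -> R) (u v : R) : R :=
  sup [set abs_error f u v x | x in `[u, v]].

(* The breakpoints x_1, ..., x_N are x`_0, ..., x`_(N.-1).  For N = 0 the
   default value of nth leaks into the definition; only N >= 2 is meant. *)
Definition breakpoint_set (R : realType) (a b : R) (N : nat)
    (x : N.-tuple R) : Prop :=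
  [/\ x`_0 = a, x`_(N.-1) = b
    & forall i, (i.+1 < N)%N -> x`_i < x`_i.+1].

(* The seed 0 is harmless: max_error is nonnegative. *)
Definition Emax (R : realType) (f : R -> R) (N : nat) (x : N.-tuple R) : R :=
  \big[Num.max/0]_(i < N.-1) max_error f x`_i x`_i.+1.

Definition equal_errors (R : realType) (f : R -> R) (N : nat)
    (x : N.-tuple R) : Prop :=
  forall i, (i.+2 < N)%N ->
    max_error f x`_i x`_i.+1 = max_error f x`_i.+1 x`_i.+2.

Definition optimal (R : realType) (a b : R) (f : R -> R) (N : nat)
    (x : N.-tuple R) : Prop :=
  breakpoint_set a b x /\
  forall y : N.-tuple R, breakpoint_set a b y -> Emax f x <= Emax f y.

(* N breakpoints are not redundant: f is not reproduced exactly by linear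
   interpolation at N - 1 breakpoints.  Otherwise a breakpoint can be added to
   an exact breakpoint set at any new place, all errors staying equal to 0, so
   that equal errors do not determine the breakpoints (take f affine). *)
Definition not_exact_with_fewer (R : realType) (a b : R) (f : R -> R)
    (N : nat) : Prop :=
  forall z : (N.-1).-tuple R, breakpoint_set a b z -> Emax f z != 0.

(* Main.v *)
(* By concavity the error E(u, v) is monotone in the interval, and shrinking an
   interval while keeping one endpoint leaves the error unchanged only when it
   is 0.  Any two breakpoint sets x, y with N points admit an i with
   [x_i, x_(i+1)] included in [y_i, y_(i+1)], so equal errors give optimality.
   Two sets with equal errors thus share the same error; if they differ, the
   first disagreement forces it to be 0, and there one of the breakpoints is
   interior to an interval on which f is affine and can be deleted. *)
Require Import Defs.
From mathcomp Require Import all_boot all_order all_algebra.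
From mathcomp Require Import all_classical all_reals all_analysis.
From mathcomp Require Import ring lra zify.

Import Order.TTheory GRing.Theory Num.Theory.

Local Open Scope ring_scope.

Set Implicit Arguments.
Unset Strict Implicit.
Unset Printing Implicit Defensive.

(** * Chords and interval errors of an arbitrary function *)

Section Chords.
Context {R : realType} (f : R -> R).
Implicit Types u v p q x : R.

Lemma chord_left u v : chord f u v u = f u.
Proof. by rewrite /chord subrr mulr0 addr0. Qed.

Lemma chord_right u v : u < v -> chord f u v v = f v.
Proof.
move=> uv; have v0 : v - u != 0 by rewrite subr_eq0 gt_eqF.
by rewrite /chord divfK // addrC subrK.
Qed.

(** A chord is affine in [x] whatever its slope, so its values at any two points [p < q] determine
    it; the slope can be abstracted before [field]. *)
Lemma chord_interpolation u v p q x : p < q ->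
  chord f u v x =
  (q - x) / (q - p) * chord f u v p + (x - p) / (q - p) * chord f u v q.
Proof.
move=> pq; have q0 : q - p != 0 by rewrite subr_eq0 gt_eqF.
rewrite /chord; move: ((f v - f u) / (v - u)) => s; by field.
Qed.

Lemma chordE u v x : u < v ->
  chord f u v x = (v - x) / (v - u) * f u + (x - u) / (v - u) * f v.
Proof.
by move=> uv; rewrite (chord_interpolation u v x uv) chord_left chord_right.
Qed.

Lemma weight_ge0 p q x : p < q -> p <= x <= q ->
  0 <= (q - x) / (q - p) /\ 0 <= (x - p) / (q - p).
Proof.
by move=> pq /andP[px xq]; split; rewrite divr_ge0 // subr_ge0 // ltW.
Qed.

Lemma chord_le_chord u v p q x : p < q -> p <= x <= q ->
  chord f u v p <= f p -> chord f u v q <= f q ->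
  chord f u v x <= chord f p q x.
Proof.
move=> pq pxq lep leq; have [w1 w2] := weight_ge0 pq pxq.
rewrite (chord_interpolation u v x pq) (chordE x pq).
by apply: lerD; apply: ler_wpM2l.
Qed.

Lemma chord_affine u v c d : u < v ->
  (forall x, u <= x <= v -> f x = c + d * x) ->
  forall x, chord f u v x = c + d * x.
Proof.
move=> uv fE x; have v0 : v - u != 0 by rewrite subr_eq0 gt_eqF.
by rewrite chordE // !fE ?lexx ?(ltW uv) //; field.
Qed.

(** A maximiser makes the set of errors nonempty and bounded, so its [sup] is a genuine maximum. *)
Lemma max_error_attained u v : has_max_error f u v ->
  exists2 m, u <= m <= v & max_error f u v = abs_error f u v m /\
    forall x, u <= x <= v -> abs_error f u v x <= max_error f u v.
Proof.
case=> m mI ub.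
have ubS : ubound [set abs_error f u v x | x in `[u, v]]%classic
             (abs_error f u v m).
  by move=> _ [x xI <-]; apply: ub.
have mS : [set abs_error f u v x | x in `[u, v]]%classic (abs_error f u v m).
  by exists m.
have E : max_error f u v = abs_error f u v m.
  apply/eqP; rewrite eq_le; apply/andP; split.
    by apply: ge_sup => //; exists (abs_error f u v m).
  by apply: ub_le_sup => //; exists (abs_error f u v m).
exists m; first by move: mI; rewrite in_itv.
by split=> // x xI; rewrite E; apply: ub; rewrite in_itv.
Qed.

Lemma exact_of_max_error_eq0 u v : has_max_error f u v ->
  max_error f u v = 0 -> forall x, u <= x <= v -> f x = chord f u v x.
Proof.
move=> /max_error_attained[m _ [_ ub]] E0 x /ub.
by rewrite E0 normr_le0 subr_eq0 => /eqP.
Qed.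

Lemma max_error_affine u v c d : u < v -> has_max_error f u v ->
  (forall x, u <= x <= v -> f x = c + d * x) -> max_error f u v = 0.
Proof.
move=> uv /max_error_attained[m mI [-> _]] fE.
by rewrite /abs_error (chord_affine uv fE) fE // subrr normr0.
Qed.

End Chords.

(** * Interval errors of a concave function *)

Section ConcaveErrors.
Context {R : realType} (a b : R) (f : R -> R).
Hypothesis f_concave : concave_on a b f.
Hypothesis f_max :
  forall u v : R, a <= u -> u < v -> v <= b -> has_max_error f u v.
Implicit Types u v x : R.

Lemma chord_le u v x : a <= u -> u < v -> v <= b -> u <= x <= v ->
  chord f u v x <= f x.
Proof.
move=> au uv vb uxv; have [w1 w2] := weight_ge0 uv uxv.
have v0 : v - u != 0 by rewrite subr_eq0 gt_eqF.
have w1E : (v - x) / (v - u) = 1 - (x - u) / (v - u) by field.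
have w1le : (v - x) / (v - u) <= 1 by rewrite w1E; lra.
have uI : u \in (`[a, b]%classic : set R).
  by rewrite inE /= in_itv /= au /= (le_trans (ltW uv)).
have vI : v \in (`[a, b]%classic : set R).
  by rewrite inE /= in_itv /= vb andbT (le_trans au (ltW uv)).
have := f_concave (Itv01 w1 w1le) uI vI.
(* The parameter of [conv] is the weight of its first point, here [u]. *)
have -> : conv (Itv01 w1 w1le) (u : convex_lmodType R^o) v = x.
  by apply: etrans (convRE _ _ _) _; rewrite /= /unstable.onem; field.
rewrite convRE /= /unstable.onem.
by rewrite chordE // w1E; lra.
Qed.

Lemma abs_errorE u v x : a <= u -> u < v -> v <= b -> u <= x <= v ->
  abs_error f u v x = f x - chord f u v x.
Proof. by move=> *; rewrite /abs_error ger0_norm // subr_ge0 chord_le. Qed.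

Lemma chord_monotone u v p q x : a <= u -> u <= p -> p < q -> q <= v ->
  v <= b -> p <= x <= q -> chord f u v x <= chord f p q x.
Proof.
move=> au up pq qv vb pxq; have uv : u < v by lra.
by apply: chord_le_chord => //; apply: chord_le => //; lra.
Qed.

(** At a point of maximal error over [[p, q]], the chord over [[u, v]] lies below the one over
    [[p, q]], hence further below [f]. *)
Lemma max_error_monotone u v p q : a <= u -> u <= p -> p < q -> q <= v ->
  v <= b -> max_error f p q <= max_error f u v.
Proof.
move=> au up pq qv vb; have uv : u < v by lra.
have [|m mI [-> _]] := @max_error_attained _ f p q; first by apply: f_max; lra.
have [|_ _ [_ /(_ m)]] := @max_error_attained _ f u v; first exact: f_max.
have := chord_monotone au up pq qv vb mI.
by rewrite !abs_errorE; try lra.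
Qed.

(* Equality forces the chord over [u, q] to stay below the one over [u, v] at
   the point m of maximal error, hence f q to lie on the latter; concavity then
   puts f m on it too. *)
Lemma max_error_eq0 u q v : a <= u -> u < q -> q < v -> v <= b ->
  max_error f u q = max_error f u v -> max_error f u q = 0.
Proof.
move=> au uq qv vb Eq; have uv : u < v by lra.
have qb : q <= b by lra.
have [|m mI [Em _]] := @max_error_attained _ f u q; first exact: f_max.
have [|_ _ [_ /(_ m)]] := @max_error_attained _ f u v; first exact: f_max.
rewrite -Eq Em !abs_errorE //; try lra.
move=> /(_ ltac:(lra)) le_uv.
have := chord_monotone au (lexx u) uq (ltW qv) vb mI.
(* At [m = u] the error is 0 at once; otherwise [f q] has positive weight in the chord over [[u, q]]
   at [m], and this weight can be cancelled. *)
have [->|m_neq_u] := eqVneq m u; first by rewrite !chord_left; lra.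
have um : u < m by rewrite lt_neqAle eq_sym m_neq_u; lra.
have mv : m < v by lra.
have f_le : f q <= chord f u v q.
  have w : 0 < (m - u) / (q - u) by rewrite divr_gt0 //; lra.
  rewrite -(ler_pM2l w); move: le_uv.
  by rewrite (chord_interpolation f u v m uq) (chordE f m uq) chord_left; lra.
have : f m <= chord f u v m.
  have [<-//|q_neq_m] := eqVneq q m.
  have mq : m < q by rewrite lt_neqAle eq_sym q_neq_m; lra.
  have w : 0 < (v - q) / (v - m) by rewrite divr_gt0 //; lra.
  rewrite -(ler_pM2l w).
  have : chord f m v q <= f q by apply: chord_le; lra.
  rewrite (chordE f q mv); move: f_le.
  by rewrite (chord_interpolation f u v q mv) (chord_right f uv); lra.
have := chord_le au uv vb (_ : u <= m <= v).
by move=> /(_ ltac:(lra)); lra.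
Qed.

(** The two chords coincide with [f], hence with each other, on a nondegenerate common interval;
    being affine they are the same line, which [f] follows on all of [[p, s]]. *)
Lemma max_error_overlap p q r s : a <= p -> p <= r -> r < q -> r < s ->
  q <= b -> s <= b -> max_error f p q = 0 -> max_error f r s = 0 ->
  max_error f p s = 0.
Proof.
move=> ap pr rq rs qb sb Epq Ers; have ps : p < s by lra.
have pq : p < q by lra.
have Lpq := exact_of_max_error_eq0 (f_max ap pq qb) Epq.
have Lrs := exact_of_max_error_eq0 (f_max (le_trans ap pr) rs sb) Ers.
have chordC u v x :
    chord f u v x = chord f u v 0 + (chord f u v 1 - chord f u v 0) * x.
  by rewrite (chord_interpolation f u v x ltr01); field.
(* Either of [q] and [s] may come first; [[r, t]] lies in both intervals. *)
pose t := Num.min q s.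
have [rt tq ts] : [/\ r < t, t <= q & t <= s].
  by rewrite lt_min rq rs !ge_min !lexx orbT.
have same x : chord f p q x = chord f r s x.
  rewrite (chord_interpolation f p q x rt) (chord_interpolation f r s x rt).
  by rewrite -!Lpq ?Lrs //; lra.
apply: (max_error_affine (c := chord f p q 0)
          (d := chord f p q 1 - chord f p q 0) ps (f_max ap ps sb)) => x xI.
rewrite -chordC.
have [xq|qx] := leP x q; last by rewrite same; apply: Lrs; lra.
by apply: Lpq; lra.
Qed.

End ConcaveErrors.

(** * Comparison of breakpoint sets and deletion of a breakpoint *)

Section BreakpointSets.
Context {R : realType} (a b : R) (f : R -> R).
Hypothesis f_concave : concave_on a b f.
Hypothesis f_max :
  forall u v : R, a <= u -> u < v -> v <= b -> has_max_error f u v.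

Lemma breakpoint_le N (x : N.-tuple R) i j : breakpoint_set a b x ->
  (i <= j < N)%N -> x`_i <= x`_j.
Proof.
case=> _ _ inc /andP[]; elim: j => [|j IHj]; first by rewrite leqn0 => /eqP ->.
rewrite leq_eqVlt => /predU1P[->//|ij jN].
by rewrite (le_trans (IHj ij (ltnW jN))) // ltW // inc.
Qed.

Lemma breakpoint_bounds N (x : N.-tuple R) i : breakpoint_set a b x ->
  (i < N)%N -> a <= x`_i <= b.
Proof.
move=> xbp iN; have [<- <- _] := xbp.
by rewrite !(breakpoint_le xbp) //=; lia.
Qed.

Lemma breakpoint_has_max_error N (x : N.-tuple R) i : breakpoint_set a b x ->
  (i.+1 < N)%N -> has_max_error f x`_i x`_i.+1.
Proof.
move=> xbp iN; have [_ _ inc] := xbp; apply: f_max (inc _ iN) _.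
  by have /andP[] := breakpoint_bounds xbp (ltnW iN).
by have /andP[] := breakpoint_bounds xbp iN.
Qed.

Lemma le_Emax N (x : N.-tuple R) i : (i.+1 < N)%N ->
  max_error f x`_i x`_i.+1 <= Emax f x.
Proof.
move=> iN; have iN1 : (i < N.-1)%N by lia.
exact: (le_bigmax 0 (fun j : 'I_N.-1 => max_error f x`_j x`_j.+1)
          (Ordinal iN1)).
Qed.

Lemma Emax_eq_error N (x : N.-tuple R) i : breakpoint_set a b x ->
  equal_errors f x -> (i.+1 < N)%N -> Emax f x = max_error f x`_i x`_i.+1.
Proof.
move=> xbp xeq iN; apply/eqP; rewrite eq_le le_Emax // andbT.
have const j : (j.+1 < N)%N ->
    max_error f x`_j x`_j.+1 = max_error f x`_0 x`_1.
  by elim: j => // j IHj jN; rewrite -xeq // IHj // ltnW.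
apply: bigmax_le => [|j _].
  have [m _ [-> _]] := max_error_attained (breakpoint_has_max_error xbp iN).
  exact: normr_ge0.
by rewrite !const //; have := ltn_ord j; lia.
Qed.

(** Starting from the common endpoint [a], the inequality [y_i <= x_i] propagates until some
    interval of [x] is nested in that of [y]; failing that, the last intervals are nested, since
    both end at [b]. *)
Lemma nested_interval N (x y : N.-tuple R) : (1 < N)%N ->
  breakpoint_set a b x -> breakpoint_set a b y ->
  exists2 i, (i.+1 < N)%N & y`_i <= x`_i /\ x`_i.+1 <= y`_i.+1.
Proof.
move=> N1 [x0 xN _] [y0 yN _]; apply: contrapT => none.
have le_yx i : (i < N)%N -> y`_i <= x`_i.
  elim: i => [|i IHi] iN; first by rewrite x0 y0.
  rewrite leNgt; apply/negP => lt_xy; apply: none.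
  by exists i => //; rewrite IHi ?(ltnW iN) // ltW.
apply: none; exists N.-2; first by lia.
have E : N.-2.+1 = N.-1 by lia.
by rewrite E xN yN le_yx //; lia.
Qed.

Lemma equal_errors_optimal N (x : N.-tuple R) : (1 < N)%N ->
  breakpoint_set a b x -> equal_errors f x -> optimal a b f x.
Proof.
move=> N1 xbp xeq; split=> // y ybp.
have [i iN [yx xy]] := nested_interval N1 xbp ybp.
rewrite (Emax_eq_error xbp xeq iN); apply: le_trans (le_Emax y iN).
have /andP[ay _] := breakpoint_bounds ybp (ltnW iN).
have /andP[_ yb] := breakpoint_bounds ybp iN.
by have [_ _ inc] := xbp; apply: (max_error_monotone f_concave) (inc _ iN) _ _.
Qed.

(** [bump i] enumerates the indices in increasing order, skipping [i]. *)
Definition delete_breakpoint N (y : N.-tuple R) (i : nat) : N.-1.-tuple R :=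
  [tuple y`_(bump i k) | k < N.-1].

Lemma nth_delete_breakpoint N (y : N.-tuple R) i k : (k < N.-1)%N ->
  (delete_breakpoint y i)`_k = y`_(bump i k).
Proof. by move=> kN; rewrite (nth_mktuple _ _ (Ordinal kN)). Qed.

Lemma delete_breakpoint_set N (y : N.-tuple R) i : (0 < i < N.-1)%N ->
  breakpoint_set a b y -> breakpoint_set a b (delete_breakpoint y i).
Proof.
move=> /andP[i0 iN] [y0 yN inc]; split=> [||k kN].
- by rewrite nth_delete_breakpoint; [rewrite /bump leqNgt i0|lia].
- rewrite nth_delete_breakpoint; last by lia.
  have -> : bump i N.-2 = N.-1 by rewrite /bump; lia.
  exact: yN.
rewrite !nth_delete_breakpoint; [|lia..].
(* [bump i] keeps [k] and [k.+1] consecutive unless [k.+1 = i], where the two intervals around the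
   deleted point merge. *)
have [ki|ki] := eqVneq k.+1 i; last first.
  have -> : bump i k.+1 = (bump i k).+1 by rewrite /bump; lia.
  by apply: inc; rewrite /bump; lia.
have [-> ->] : bump i k = k /\ bump i k.+1 = k.+2 by rewrite /bump; lia.
by apply: lt_trans (inc k _) (inc k.+1 _); lia.
Qed.

Lemma Emax_delete_breakpoint N (y : N.-tuple R) i :
  (forall j, (j.+1 < N)%N -> max_error f y`_j y`_j.+1 = 0) ->
  (i.+1 < N)%N -> max_error f y`_i.-1 y`_i.+1 = 0 ->
  Emax f (delete_breakpoint y i) = 0.
Proof.
move=> y0 iN Ei; rewrite /Emax.
apply: (big_ind (fun e => e = 0)) => // [_ _ -> ->|k _]; first exact: maxxx.
have kN := ltn_ord k.
rewrite !nth_delete_breakpoint; [|lia..].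
have [ki|ki] := eqVneq k.+1 i; last first.
  have -> : bump i k.+1 = (bump i k).+1 by rewrite /bump; lia.
  by apply: y0; rewrite /bump; lia.
have [-> ->] : bump i k = i.-1 /\ bump i k.+1 = i.+1 by rewrite /bump; lia.
exact: Ei.
Qed.

(* At the first disagreement [y_i < x_i] the interval [y_(i-1), y_i] is strictly
   contained in [x_(i-1), x_i], so all errors vanish; the exact intervals
   [x_(i-1), x_i] and [y_i, y_(i+1)] overlap, so y_i is redundant. *)
Lemma redundant_breakpoint N (x y : N.-tuple R) i : (i < N)%N ->
  breakpoint_set a b x -> breakpoint_set a b y ->
  equal_errors f x -> equal_errors f y -> Emax f x = Emax f y ->
  (forall j, (j < i)%N -> x`_j = y`_j) -> y`_i < x`_i ->
  exists2 z : N.-1.-tuple R, breakpoint_set a b z & Emax f z = 0.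
Proof.
case: i => [|i] iN xbp ybp xeq yeq Exy agree lt_yx.
  by move: lt_yx; case: xbp ybp => [-> _ _] [-> _ _]; rewrite ltxx.
have [_ xN xinc] := xbp; have [_ yN yinc] := ybp.
have iN2 : (i.+2 < N)%N.
  (* The disagreement, now at index [i.+1], is not at the last index, where both sets equal [b]; so
     [y] has a further breakpoint. *)
  rewrite ltn_neqAle iN andbT; apply/eqP => E.
  by move: lt_yx; rewrite (_ : i.+1 = N.-1) ?xN ?yN ?ltxx //; lia.
have xyi := agree i (ltnSn i).
have /andP[ax _] := breakpoint_bounds xbp (ltnW iN).
have /andP[_ xb] := breakpoint_bounds xbp iN.
have /andP[_ yb] := breakpoint_bounds ybp iN2.
have E0 : max_error f y`_i y`_i.+1 = 0.
  apply: (max_error_eq0 f_concave f_max _ (yinc _ iN) lt_yx xb); rewrite -xyi //.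
  by rewrite {1}xyi -(Emax_eq_error xbp xeq iN) -(Emax_eq_error ybp yeq iN).
have Ey : Emax f y = 0 by rewrite (Emax_eq_error ybp yeq iN).
exists (delete_breakpoint y i.+1).
  by apply: delete_breakpoint_set => //; lia.
apply: Emax_delete_breakpoint => // [j jN|/=].
  by rewrite -(Emax_eq_error ybp yeq jN).
apply: (max_error_overlap f_max _ (ltW (yinc _ iN)) lt_yx (yinc _ iN2) xb yb).
- by rewrite -xyi.
- by rewrite -xyi -(Emax_eq_error xbp xeq iN) Exy.
- by rewrite -(Emax_eq_error ybp yeq iN2).
Qed.

End BreakpointSets.

Theorem theorem3 (R : realType) (a b : R) (f : R -> R) (N : nat)
    (f_concave : concave_on a b f)
    (f_max : forall u v : R, a <= u -> u < v -> v <= b -> has_max_error f u v)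
    (N_ge3 : (3 <= N)%N)
    (x : N.-tuple R)
    (x_bp : breakpoint_set a b x)
    (x_eq : equal_errors f x) :
  (not_exact_with_fewer a b f N ->
     forall y : N.-tuple R,
       breakpoint_set a b y -> equal_errors f y -> y = x) /\
  optimal a b f x.
Proof.
have opt z := @equal_errors_optimal _ a b f f_concave f_max N z (ltnW N_ge3).
split=> [inexact y y_bp y_eq|]; last exact: opt.
have Exy : Emax f x = Emax f y.
  apply/eqP; rewrite eq_le.
  by rewrite (opt x x_bp x_eq).2 // (opt y y_bp y_eq).2.
apply/val_inj/eqP; apply: contraT => /eqP neq_yx.
have [|i neq_i min_i] := @ex_minnP (fun i => y`_i != x`_i).
  apply: contrapT => none; apply: neq_yx.
  apply: (@eq_from_nth _ 0) => [|i _]; first by rewrite !size_tuple.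
  by apply: contrapT => /eqP neq_i; apply: none; exists i.
(* Past the end both sequences take the default value 0, so they cannot disagree there. *)
have iN : (i < N)%N.
  rewrite ltnNge; apply: contra neq_i => Ni.
  by rewrite !nth_default ?size_tuple.
have agree j : (j < i)%N -> y`_j = x`_j.
  by move=> ji; apply/eqP; apply: contraTT ji => /min_i; rewrite -leqNgt.
have no_z : ~ exists2 z : N.-1.-tuple R, breakpoint_set a b z & Emax f z = 0.
  by case=> z /inexact /eqP.
(* Whichever set has the smaller breakpoint at [i] plays the role of [y] in
   [redundant_breakpoint]. *)
case: no_z; move: neq_i; rewrite neq_lt => /orP[lt_yx|lt_xy].
  apply: (redundant_breakpoint f_concave f_max iN x_bp y_bp) => // j /agree.
  exact: esym.
exact: (redundant_breakpoint f_concave f_max iN y_bp x_bp).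
Qed.
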